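(* Let $\alpha$ and $\beta$ be compositions. Then $\mathbf s_{\alpha/\beta}:=\mathbf s_\alpha/F_\beta$ equals $\mathbf s_{\beta\backslash\alpha}:=F_\beta\backslash\mathbf s_\alpha$. Moreover, one has $$\mathbf s_{\alpha/\beta}=\sum_{\substack{\alpha=\gamma\sqcup\delta\\\beta\in[\delta]}}\mathbf s_\gamma=\sum_{\substack{\alpha=\gamma\sqcup\delta\\\gamma'\in[\gamma]\\\beta\in[\delta]}}\mathbf s_{\gamma'}\qquad\text{and}\qquad\mathbf s_{\beta\backslash\alpha}=\sum_{\substack{\alpha=\gamma\sqcup\delta\\\beta\in[\gamma]}}\mathbf s_\delta=\sum_{\substack{\alpha=\gamma\sqcup\delta\\\beta\in[\gamma]\\\delta'\in[\delta]}}\mathbf s_{\delta'} .$$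
   Context: A composition $\alpha=(\alpha_1,\ldots,\alpha_\ell)$ of $n$ is a sequence of positive integers with sum $n$; $D(\alpha)=\{\alpha_1,\alpha_1+\alpha_2,\ldots,\alpha_1+\cdots+\alpha_{\ell-1}\}$. It is identified with its ribbon diagram: rows of lengths $\alpha_1,\ldots,\alpha_\ell$ from bottom to top, the last box of each row directly below the first box of the next row up. $\alpha\cdot\beta$ is concatenation and $\alpha\rhd\beta=(\alpha_1,\ldots,\alpha_{\ell-1},\alpha_\ell+\beta_1,\beta_2,\ldots)$. A generalized ribbon $\alpha=\alpha^1\oplus\cdots\oplus\alpha^k$ is a skew diagram whose connected components are ribbons $\alpha^1,\ldots,\alpha^k$, with $\alpha^{i+1}$ strictly northeast of $\alpha^i$. $[\alpha^1]=\{\alpha^1\}$, $[\alpha]=\{\beta\cdot\alpha^k,\ \beta\rhd\alpha^k:\beta\in[\alpha^1\oplus\cdots\oplus\alpha^{k-1}]\}$, $[\emptyset]=\{\emptyset\}$. $\mathbf{NSym}$ is the free associative ring $\mathbb Z\langle\mathbf h_1,\mathbf h_2,\ldots\rangle$, a Hopf algebra with $\Delta\mathbf h_k=\sum_{0\le i\le k}\mathbf h_i\otimes\mathbf h_{k-i}$ ($\mathbf h_0=1$). It is realized in noncommuting variables $\mathbf x_i$ ($i\in\mathbb Z$) by $\mathbf h_k=\sum_{i_1\le\cdots\le i_k}\mathbf x_{i_1}\cdots\mathbf x_{i_k}$. For a generalized ribbon $\alpha$, $\mathbf s_\alpha=\sum_\tau\mathbf x_{w_1}\cdots\mathbf x_{w_n}$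 over all fillings $\tau$ of $\alpha$ with integers, rows weakly increasing left to right and columns strictly increasing top to bottom, where $w_1\cdots w_n$ is the reading word of $\tau$ (rows from bottom to top, each left to right); $\mathbf s_\emptyset=1$. These lie in $\mathbf{NSym}$, and the $\mathbf s_\alpha$ for compositions $\alpha$ form a $\mathbb Z$-basis. $\mathrm{QSym}$, with basis the fundamental quasisymmetric functions $F_\alpha=\sum x_{i_1}\cdots x_{i_n}$ (over $1\le i_1\le\cdots\le i_n$ with $i_j<i_{j+1}$ for $j\in D(\alpha)$), is the graded dual Hopf algebra of $\mathbf{NSym}$, with $\{F_\alpha\}$ dual to $\{\mathbf s_\alpha\}$; so $F_\beta$ is the linear functional on $\mathbf{NSym}$ with $F_\beta(\mathbf s_\alpha)=\delta_{\alpha\beta}$ for compositions $\alpha,\beta$. For $a\in\mathbf{NSym}$ with $\Delta(a)=\sum a_1\otimes a_2$ and $f\in\mathrm{QSym}$, the skewing operations are $a/f:=\sum a_1f(a_2)$ and $f\backslash a:=\sum f(a_1)a_2$. Decompositions $\alpha=\gamma\sqcup\delta$: fill each box of the ribbon $\alpha$ with one of two symbols $\gamma<\delta$ so that each row is weakly increasing from left to right and each column is weakly increasing from top to bottom. The boxes filled with $\gamma$ form a generalized ribbon denoted $\gamma$, those filled with $\delta$ a generalized ribbon denoted $\delta$ (either may be empty). Sums have one term (resp. one for each $\gamma'$ or $\delta'$) for each such filling. *)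

(* Defs.v *)
From HB Require Import structures.
From mathcomp Require Import all_boot all_order all_algebra.
From mathcomp Require Import finmap.
From mathcomp.multinomials Require Import monalg.
From Stdlib Require Import ClassicalEpsilon.

Set Implicit Arguments.
Unset Strict Implicit.
Unset Printing Implicit Defensive.

Import Order.TTheory GRing.Theory Num.Theory.

Local Open Scope ring_scope.
Local Open Scope fset_scope.

Definition posint := {n : nat | (0 < n)%N}.
Definition pos1 : posint := exist _ 1%N isT.
Definition addp (m n : posint) : posint :=
  exist _ (val m + val n)%N (ltn_addr (val n) (valP m)).

Definition composition := seq posint.

(* The concatenation of two compositions is [++]; this is their
   near-concatenation, written with a triangle in the literature. *)
Fixpoint nearcat (a b : composition) {struct a} : composition :=
  match a, b with
  | [::], _ => b
  | [:: x], y :: b' => addp x y :: b'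
  | x :: a', _ => x :: nearcat a' b
  end.

(* A cell is a pair (row, column); rows are numbered from bottom to top and
   columns from left to right.  A diagram is the list of its cells in reading
   order: rows from bottom to top, each row from left to right. *)
Definition cell := (nat * nat)%type.
Definition diagram := seq cell.

Fixpoint ribbon_from (r c : nat) (a : composition) : diagram :=
  if a is k :: a' then
    [seq (r, j) | j <- iota c (val k)]
      ++ ribbon_from r.+1 (c + (val k).-1)%N a'
  else [::].

Definition ribbon (a : composition) : diagram := ribbon_from 0 0 a.

(* The filling of D whose reading word is w: rows are increasing from left to
   right for rrow, columns are increasing from top to bottom for rcol. *)
Definition is_filling (T : Type) (x0 : T) (rrow rcol : rel T)
    (D : diagram) (w : seq T) : bool :=
  let v c := nth x0 w (index c D) in
  (size w == size D) &&
  all (fun c => all (fun d =>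
    ((c.1 == d.1) && (c.2 < d.2)%N ==> rrow (v c) (v d)) &&
    ((c.2 == d.2) && (d.1 < c.1)%N ==> rcol (v c) (v d))) D) D.

(* The components of a generalized ribbon, from southwest to northeast.  As a
   ribbon is read, each cell other than the first is immediately to the right
   of the previous one or immediately above it; components are the maximal
   runs of such steps. *)
Fixpoint components (D : diagram) : seq composition :=
  if D is c :: D' then
    if components D' is (k :: a) :: g then
      let d := head c D' in
      if d == (c.1, c.2.+1) then (addp pos1 k :: a) :: g
      else if d == (c.1.+1, c.2) then (pos1 :: k :: a) :: g
      else [:: pos1] :: (k :: a) :: g
    else [:: [:: pos1]]
  else [::].

(* The set [g] attached to the generalized ribbon with components g. *)
Definition rclass (g : seq composition) : {fset composition} :=
  if g is a :: g' then
    foldl (fun (B : {fset composition}) (c : composition) =>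
             [fset b ++ c | b in B] `|` [fset nearcat b c | b in B])
          [fset a] g'
  else [fset [::]].

(* The product monoid, so that the monoid ring of M * N is the tensor product
   of those of M and N. *)
Section ProdMonom.
Variables M N : monomType.
Implicit Types x y z : (M * N)%type.

Definition prodm_mul x y : (M * N)%type := (mmul x.1 y.1, mmul x.2 y.2).

Fact prodm_mulA : associative prodm_mul.
Proof. by move=> x y z; rewrite /prodm_mul /= !mulmA. Qed.

Fact prodm_mul1m : left_id (mone, mone) prodm_mul.
Proof. by case=> x y; rewrite /prodm_mul /= !mul1m. Qed.

Fact prodm_mulm1 : right_id (mone, mone) prodm_mul.
Proof. by case=> x y; rewrite /prodm_mul /= !mulm1. Qed.

Fact prodm_unitm x y :
  prodm_mul x y = (mone, mone) -> x = (mone, mone) /\ y = (mone, mone).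
Proof. by case: x y => [x x'] [y y'] [] /unitm[-> ->] /unitm[-> ->]. Qed.

HB.instance Definition _ := Choice_isMonomialDef.Build (M * N)%type
  prodm_mulA prodm_mul1m prodm_mulm1 prodm_unitm.
End ProdMonom.

(* The free ring on h_1, h_2, ..., and its tensor square. *)
Definition word := {fmonom posint}.
Definition NSym := {malg int[word]}.
Definition NSym2 := {malg int[(word * word)%type]}.

Definition hNSym (n : nat) : NSym :=
  if insub n is Some k then << fmu k >> else 1.

Definition tens (a b : NSym) : NSym2 :=
  \sum_(u <- msupp a) \sum_(v <- msupp b) << a@_u * b@_v *g (u, v) >>.

(* The ring morphism sending h_k to the sum of the h_i (x) h_(k-i). *)
Definition coprod : NSym -> NSym2 :=
  mmap (fun z : int => z%:~R)
       (fun m : word => \prod_(k <- m)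
          \sum_(i < (val k).+1) tens (hNSym i) (hNSym (val k - i))).

(* Formal series in noncommuting variables x_i (i in Z): the coefficient of
   x_(w_1) ... x_(w_n) is the value at the word w. *)
Definition series := seq int -> int.

Definition series1 : series := fun w => (w == [::])%:R.
Definition mul_series (f g : series) : series := fun w =>
  \sum_(i < (size w).+1) f (take i w) * g (drop i w).

Definition h_series (n : nat) : series := fun w =>
  ((size w == n) && sorted <=%R w)%:R.

Definition realize (a : NSym) : series := fun w =>
  \sum_(m <- msupp a)
    a@_m * foldr mul_series series1 [seq h_series (val k) | k <- m] w.

(* A filling is determined by its reading word, so each word has
   coefficient 0 or 1. *)
Definition s_series (D : diagram) : series := fun w =>
  (is_filling 0 <=%R <%R D w)%:R.

(* The element of NSym realized as s_series D; it exists when D is a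
   generalized ribbon, and is unique because realize is injective. *)
Definition sNSym (D : diagram) : NSym :=
  epsilon (inhabits 0) (fun a => forall w, realize a w = s_series D w).

(* The fundamental quasisymmetric function F_b as a Z-linear functional on
   NSym: QSym is the graded dual of NSym, with F_b dual to the basis of the
   sNSym (ribbon a). *)
Definition Ffun (b : composition) : {additive NSym -> int} :=
  epsilon (inhabits (\0 : {additive NSym -> int}))
    (fun f => forall a : composition, f (sNSym (ribbon a)) = (a == b)%:R).

(* a / f *)
Definition skewr (a : NSym) (f : NSym -> int) : NSym :=
  \sum_(p <- msupp (coprod a)) (coprod a)@_p * f << p.2 >> *: << p.1 >>.

(* f \ a *)
Definition skewl (f : NSym -> int) (a : NSym) : NSym :=
  \sum_(p <- msupp (coprod a)) (coprod a)@_p * f << p.1 >> *: << p.2 >>.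

(* A decomposition of a is given by the reading word of a filling, with false
   and true for the symbols gamma < delta. *)
Definition is_decomp (a : composition) (t : (size (ribbon a)).-tuple bool) : bool :=
  is_filling false implb implb (ribbon a) t.

Definition gpart (a : composition) (t : (size (ribbon a)).-tuple bool) : diagram :=
  mask (map negb t) (ribbon a).
Definition dpart (a : composition) (t : (size (ribbon a)).-tuple bool) : diagram :=
  mask t (ribbon a).

Arguments is_decomp : clear implicits.
Arguments gpart : clear implicits.
Arguments dpart : clear implicits.

(* Main.v *)
(* A diagram is encoded by the word of steps (right, up, or jump to a new
   component) between consecutive cells in reading order.  The elements s_g are
   then given by a recursion on step words coming from the product rule
   s_a s_b = s_(a.b) + s_(a|>b), where s_a s_b is also the element of the diagram
   with a jump between a and b: this yields s_g as the sum of the s_b for b in [g].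
   The realization is injective because the coefficients of products of the h_k at
   words with prescribed descents are triangular; F_b is the coefficient at the
   word with descent composition b.  The sum over the decompositions of a of
   s_gamma (x) s_delta satisfies the same recursion as the coproduct: at a junction
   of two ribbons, equal symbols on both sides give the product rule for one part,
   and distinct symbols allow only one of the two junctions and disconnect both
   parts.  The equality of both skewings is cocommutativity. *)

Require Import Defs.
From HB Require Import structures.
From mathcomp Require Import all_boot all_order all_algebra.
From mathcomp Require Import finmap.
From mathcomp.multinomials Require Import monalg.
From mathcomp Require Import zify.
From Stdlib Require Import ClassicalEpsilon.

Set Implicit Arguments.
Unset Strict Implicit.
Unset Printing Implicit Defensive.

Import Order.TTheory GRing.Theory Num.Theory.
Local Open Scope ring_scope.

(** * The free ring and its realization *)

(** Reduces an additive identity to basis elements. Closure under differences suffices: it yields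
    opposites, then sums, then integer multiples. *)
Lemma malg_ind (K : choiceType) (P : {malg int[K]} -> Prop) :
    P 0 -> (forall x y, P x -> P y -> P (x - y)) -> (forall m, P << m >>) ->
  forall x, P x.
Proof.
move=> P0 PB PU x.
have PN y : P y -> P (- y) by move=> Py; rewrite -sub0r; apply: PB.
have PD y z : P y -> P z -> P (y + z).
  by move=> Py Pz; rewrite -[z]opprK; apply: PB => //; apply: PN.
have PMn y n : P y -> P (y *+ n).
  by move=> Py; elim: n => [|n IHn]; rewrite ?mulr0n // mulrS; apply: PD.
rewrite [x]monalgE; elim/big_ind: _ => // m _.
have -> : << x@_m *g m >> = << m >> *~ x@_m :> {malg int[K]}.
  by rewrite -raddfMz /= intz.
by case: (x@_m) => n; rewrite ?NegzE ?mulrNz -pmulrn; [|apply: PN]; apply: PMn.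
Qed.

Lemma realizeB a b w : realize (a - b) w = realize a w - realize b w.
Proof.
(* At a fixed word, [realize] is convertible to an [mmap] with the identity on coefficients. *)
exact: (mmapB (f := idfun : {additive int -> int})
  (h := fun m : word => foldr mul_series series1 [seq h_series (val k) | k <- m] w)).
Qed.

Lemma realize0 w : realize 0 w = 0.
Proof. by rewrite -[0]subr0 realizeB subrr. Qed.

Lemma realizeU (m : word) w :
  realize << m >> w = foldr mul_series series1 [seq h_series (val k) | k <- m] w.
Proof.
rewrite -[RHS]mul1r.
exact: (mmapU (f := idfun : {additive int -> int})
  (h := fun m : word => foldr mul_series series1 [seq h_series (val k) | k <- m] w)).
Qed.

Lemma realize1 w : realize 1 w = series1 w.
Proof. by rewrite realizeU fm1. Qed.

(** In the convolution only the cut after exactly [n] letters contributes. *)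
Lemma mul_series_h n f w :
  mul_series (h_series n) f w
    = ((n <= size w)%N && sorted <=%R (take n w))%:R * f (drop n w).
Proof.
rewrite /mul_series /h_series.
case: leqP => [le_nw | lt_wn] /=; last first.
  rewrite mul0r big1 // => i _.
  by rewrite (size_takel (leq_ord i)) ltn_eqF ?mul0r // (leq_ltn_trans (leq_ord i)).
rewrite (bigD1 (inord n)) //= inordK ?ltnS // size_takel // eqxx /=.
rewrite big1 ?addr0 // => i neq_in.
rewrite (size_takel (leq_ord i)); case: eqP => [eq_in | _]; last by rewrite mul0r.
by case/eqP: neq_in; apply: val_inj; rewrite /= inordK // ltnS.
Qed.

Lemma hNSymS n : hNSym n.+1 = << fmu (exist _ n.+1 isT : posint) >>.
Proof.
by rewrite /hNSym insubT.
Qed.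

Lemma mulUU (u v : word) : << u >> * << v >> = << mmul u v >> :> NSym.
Proof. by rewrite malgM_def fgmulUU mulr1. Qed.

(** Multiplicativity for a left factor [hNSym n.+1] is enough, since [gval] uses no other
    product. *)
Lemma realize_hM n u w :
  realize (hNSym n.+1 * u) w = mul_series (h_series n.+1) (realize u) w.
Proof.
rewrite mul_series_h; move: u; apply: malg_ind.
- by rewrite mulr0 !realize0 mulr0.
- move=> x y IHx IHy; rewrite (mulrBr (hNSym n.+1)) 2!realizeB [RHS]mulrBr.
  by congr (_ - _); [apply: IHx | apply: IHy].
by move=> m; rewrite hNSymS mulUU !realizeU fmM fmU /= mul_series_h.
Qed.

(** * Step words and the ribbon recursion *)

Variant step := Right | Up | Jump.

Section Fillings.
Variables (T : Type) (rrow rcol : rel T).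

(* Each letter of a step word leads to a cell, so that a diagram with n cells
   is a word of length n; the first letter is a dummy [Jump]. *)
Fixpoint fil (x : T) (s : seq step) (w : seq T) : bool :=
  match s, w with
  | [::], [::] => true
  | e :: s', y :: w' =>
    match e with Right => rrow x y | Up => rcol y x | Jump => true end
      && fil y s' w'
  | _, _ => false
  end.

Lemma fil_cat x s1 s2 w1 w2 : size s1 = size w1 ->
  fil x (s1 ++ s2) (w1 ++ w2) = fil x s1 w1 && fil (last x w1) s2 w2.
Proof.
elim: s1 w1 x => [|e s1 IH] [|y w1] x //= [eq_sz].
by rewrite IH // andbA.
Qed.

Lemma fil_size x s w : fil x s w -> size w = size s.
Proof. by elim: s w x => [|e s IH] [|y w] x //= /andP[_ /IH->]. Qed.

Lemma fil_nseq x n w : fil x (nseq n Right) w = (size w == n) && path rrow x w.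
Proof.
elim: n w x => [|n IH] [|y w] x //=.
by rewrite IH eqSS; case: (rrow x y); rewrite ?andbF.
Qed.

Lemma fil_row x n w :
  fil x (Jump :: nseq n Right) w = (size w == n.+1) && sorted rrow w.
Proof. by case: w => [|y w] //=; rewrite fil_nseq eqSS. Qed.

End Fillings.

(* [gval j s] is the ribbon Schur function of a first row with [j.+1] cells
   followed by [s]. *)
Fixpoint gval (j : nat) (s : seq step) : NSym :=
  match s with
  | [::] => hNSym j.+1
  | Right :: s' => gval j.+1 s'
  | Up :: s' => hNSym j.+1 * gval 0 s' - gval j.+1 s'
  | Jump :: s' => hNSym j.+1 * gval 0 s'
  end.

Definition gschur (s : seq step) : NSym := if s is _ :: s' then gval 0 s' else 1.

Notation sfil := (fil (<=%R : rel int) (<%R : rel int)).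

Lemma fil_split j x e s w :
  (sfil x (Jump :: nseq j Right ++ e :: s) w)%:R
    = ((j < size w)%N && sorted <=%R (take j.+1 w))%:R
      * (sfil (last x (take j.+1 w)) (e :: s) (drop j.+1 w))%:R :> int.
Proof.
case: ltnP => [lt_jw | le_wj]; last first.
  rewrite mul0r; apply/eqP; rewrite pnatr_eq0 eqb0; apply/negP => fw; have := fil_size fw.
  by rewrite /= size_cat size_nseq /=; lia.
rewrite -{1}[w](cat_take_drop j.+1) -cat_cons fil_cat; last first.
  by rewrite /= size_nseq size_takel.
by rewrite -natrM mulnb fil_row size_takel // eqxx.
Qed.

Lemma nseq_rcat j s : nseq j Right ++ Right :: s = nseq j.+1 Right ++ s.
Proof. by elim: j => //= j ->. Qed.

Lemma realize_gval j s x w :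
  realize (gval j s) w = (sfil x (Jump :: nseq j Right ++ s) w)%:R.
Proof.
elim: s j x w => [|[] s IH] j x w.
- rewrite cats0 [gval _ _]hNSymS realizeU fmU [foldr _ _ _]/= mul_series_h.
  rewrite fil_row /series1 -natrM mulnb; congr (nat_of_bool _)%:R.
  rewrite -size_eq0 size_drop subn_eq0.
  rewrite andbAC -eqn_leq [RHS]andbC eq_sym andbC.
  by case: eqP => [<-|]; rewrite ?andbF ?take_size.
- by rewrite [gval _ _]/= (IH _ x) -nseq_rcat.
(* The product imposes nothing between the last letter of the row and the next letter; subtracting
   the weak ascents leaves the strict descents required by [Up]. *)
- rewrite [gval _ _]/= realizeB realize_hM mul_series_h (IH _ 0) (IH _ x).
  rewrite -nseq_rcat !fil_split -mulrBr; congr (_ * _).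
  case: (drop _ w) => [|y v]; rewrite ?subr0 //=.
  by rewrite ltNge; case: (_ <= y); rewrite ?subr0 ?subrr.
- rewrite [gval _ _]/= realize_hM mul_series_h (IH _ 0) fil_split.
  by congr (_ * _); case: (drop _ w).
Qed.

Lemma realize_gschur s x w :
  realize (gschur (Jump :: s)) w = (sfil x (Jump :: s) w)%:R.
Proof. exact: (realize_gval 0 s x w). Qed.

Lemma gval_jump j u v : gval j (u ++ Jump :: v) = gval j u * gval 0 v.
Proof.
elim: u j => [|[] u IH] j /=.
- exact: erefl.
- exact: IH.
- by rewrite !IH mulrBl mulrA.
- by rewrite IH mulrA.
Qed.

Lemma ring_glue (R : pzRingType) (h a b c d p q v : R) :
  a + b = p * v -> c + d = q * v -> h * a - c + (h * b - d) = (h * p - q) * v.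
Proof. by move=> ab cd; rewrite addrACA -opprD -mulrDr ab cd mulrBl mulrA. Qed.

(** The product rule for ribbon Schur functions. For empty [u] it is the defining equation of [gval]
    at [Up]; both sides then obey the same recursion in [u]. *)
Lemma gval_glue j u v :
  gval j (u ++ Right :: v) + gval j (u ++ Up :: v) = gval j u * gval 0 v.
Proof.
elim: u j => [|[] u IH] j /=.
- by rewrite addrC subrK.
- exact: IH.
- exact: ring_glue (IH 0%N) (IH j.+1).
- by rewrite -(mulrDr (hNSym j.+1)) IH mulrA.
Qed.

Lemma gschur_jump u v : gschur (u ++ Jump :: v) = gschur u * gschur (Jump :: v).
Proof. by case: u => [|e u]; rewrite ?mul1r //= gval_jump. Qed.

Lemma gschur_glue e u v :
  gschur (e :: u ++ Right :: v) + gschur (e :: u ++ Up :: v)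
    = gschur (e :: u) * gschur (Jump :: v).
Proof. exact: gval_glue. Qed.

(** * Injectivity of the realization *)

Lemma last_nseq (T : Type) n (x : T) : last x (nseq n x) = x.
Proof. by elim: n. Qed.

(* The coefficient of a ribbon Schur function at this word tells whether the
   ribbon is [a]; so [F_a] is the coefficient at this word. *)
Fixpoint descword (a : composition) : seq int :=
  if a is k :: a' then nseq (val k) (size a')%:Z ++ descword a' else [::].

Definition hprod (m : composition) : series :=
  foldr mul_series series1 [seq h_series (val k) | k <- m].

Lemma hprod_cons k m w :
  hprod (k :: m) w
    = ((val k <= size w)%N && sorted <=%R (take (val k) w))%:R
      * hprod m (drop (val k) w).
Proof. exact: mul_series_h. Qed.

Lemma sorted_nseq_cons (j : nat) (x y : int) s : (0 < j)%N -> (y < x) ->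
  sorted <=%R (nseq j x ++ y :: s) = false.
Proof.
case: j => // j _ lt_yx /=; rewrite cat_path /= last_nseq.
by rewrite leNgt lt_yx andbF.
Qed.

Lemma sorted_nseq (j : nat) (x : int) : sorted <=%R (nseq j x).
Proof. by case: j => //= j; elim: j => //= j ->; rewrite lexx. Qed.

Lemma hprod_descword m : hprod m (descword m) = 1.
Proof.
elim: m => //= k m IH; rewrite hprod_cons.
rewrite size_cat size_nseq leq_addr take_size_cat ?size_nseq //.
by rewrite drop_size_cat ?size_nseq // sorted_nseq IH.
Qed.

(** [descword b] drops strictly between its constant blocks, so a weakly increasing factor stays
    within one block. Hence [m] refines [b]. *)
Lemma hprod_triangular m b :
  hprod m (descword b) != 0 -> (size b < size m)%N \/ m = b.
Proof.
elim: m b => [|k m IH] [|l b].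
- by right.
- by case: l => [[|l] l_gt0].
- by rewrite hprod_cons /= leqNgt (valP k) mul0r.
rewrite hprod_cons [descword _]/=.
case: (ltngtP (val k) (val l)) => [lt_kl | lt_lk | /val_inj eq_kl].
- have pos_lk : (0 < val l - val k)%N by rewrite subn_gt0.
  (* The remainder of a block cut short is the word of [b] with its first part shortened, so the
     induction hypothesis still applies. *)
  have -> : drop (val k) (nseq (val l) (size b)%:Z ++ descword b)
      = descword ((exist (fun n => 0 < n)%N _ pos_lk : posint) :: b).
    by rewrite drop_cat size_nseq lt_kl drop_nseq.
  rewrite mulf_eq0 => /norP[_ /IH[lt_bm | ->]]; last by left.
  by left; rewrite /= ltnS ltnW.
(* A factor longer than the first block overruns the word or crosses into a block of smaller
   letters. *)
- case: b => [|y b].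
    by rewrite cats0 size_nseq leqNgt lt_lk mul0r eqxx.
  rewrite take_cat size_nseq ltnNge (ltnW lt_lk) /=.
  have: (0 < val k - val l)%N by rewrite subn_gt0.
  case: (_ - _)%N => // j _; case: y => [[|y] y_gt0] //.
  rewrite [take _ (nseq _ _ ++ _)]/=.
  by rewrite sorted_nseq_cons ?(valP l) ?ltz_nat ?andbF ?mul0r ?eqxx.
rewrite eq_kl drop_size_cat ?size_nseq // mulf_eq0 => /norP[_ /IH[lt_bm | ->]].
  by left; rewrite /= ltnS.
by right.
Qed.

Lemma realize_eq0 a : (forall w, realize a w = 0) -> a = 0.
Proof.
move=> a0; apply/malgP => m; rewrite mcoeff0.
(* Longest words come first: [mmeasure] bounds the lengths in the support, and the coefficient at
   [m] is isolated by [descword m] once those of longer words vanish. *)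
have [d] := ubnP (mmeasure (@fdeg posint) a - size m).
elim: d m => // d IH m le_d.
case: (msuppP a m) => // m_a.
have := a0 (descword m); rewrite /realize (bigD1_seq m) ?fset_uniq //=.
rewrite -/(hprod m _) hprod_descword mulr1 big1 ?addr0 // => m' neq_m.
rewrite -/(hprod m' _).
have [-> | /hprod_triangular[lt_m | eq_m]] := eqVneq (hprod m' (descword m)) 0.
- by rewrite mulr0.
- rewrite IH ?mul0r //.
  have: (size m < mmeasure (@fdeg posint) a)%N := mmeasure_mnm_lt (@fdeg posint) m_a.
  move: (mmeasure _ a) le_d lt_m => N; move: (size m) (size m') => i j.
  lia.
by case/eqP: neq_m; apply: val_inj.
Qed.

Lemma realize_inj a b : realize a =1 realize b -> a = b.
Proof.
move=> eq_ab; apply/eqP; rewrite -subr_eq0; apply/eqP/realize_eq0 => w.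
by rewrite realizeB eq_ab subrr.
Qed.

(** The existence of [a] makes the choice by [epsilon] meaningful, and injectivity identifies it
    with [a]. *)
Lemma sNSym_eq D a : realize a =1 s_series D -> sNSym D = a.
Proof.
move=> aD; apply: realize_inj => w; rewrite aD.
exact: (epsilon_spec _ _ (ex_intro (fun a => realize a =1 s_series D) a aD)).
Qed.

(** * Fillings as step words *)

Definition step_of (c d : cell) : step :=
  if d == (c.1, c.2.+1) then Right else if d == (c.1.+1, c.2) then Up else Jump.

Definition enc (D : diagram) : seq step :=
  if D is c :: D' then Jump :: pairmap step_of c D' else [::].

(** Stronger than what [step_of] sees: a jump must go strictly northeast, so that its two cells
    share neither row nor column. *)
Definition ribbon_step (c d : cell) : bool :=
  [|| d == (c.1, c.2.+1), d == (c.1.+1, c.2) | (c.1 < d.1)%N && (c.2 < d.2)%N].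

Definition cell_lt (c d : cell) : bool :=
  [&& (c.1 <= d.1)%N, (c.2 <= d.2)%N & c != d].

Lemma cell_lt_trans : transitive cell_lt.
Proof.
move=> d c e /and3P[le_cd1 le_cd2 neq_cd] /and3P[le_de1 le_de2 neq_de].
apply/and3P; split; rewrite ?(leq_trans le_cd1) ?(leq_trans le_cd2) //.
apply: contraNneq neq_cd => eq_ce; subst e.
by rewrite -pair_eqE /= !eqn_leq le_cd1 le_cd2 le_de1 le_de2.
Qed.

Lemma cell_lt_irr : irreflexive cell_lt.
Proof. by move=> c; rewrite /cell_lt eqxx !andbF. Qed.

Lemma ribbon_step_lt c d : ribbon_step c d -> cell_lt c d.
Proof.
case: c d => [r c] [r' c']; rewrite /ribbon_step /cell_lt -!pair_eqE /=.
by lia.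
Qed.

Section FillingPath.
Variables (T : Type) (x0 : T) (rrow rcol : rel T).
Hypotheses (rrow_trans : transitive rrow) (rcol_trans : transitive rcol).

(** The later cell of a column is the upper one, hence the exchanged arguments of [rcol]. *)
Definition compat (p q : cell * T) : bool :=
  [&& cell_lt p.1 q.1, (p.1.1 == q.1.1) ==> rrow p.2 q.2
    & (p.1.2 == q.1.2) ==> rcol q.2 p.2].

(** A cell lying between two cells of one row or column is in that row or column too. Thus the
    conditions on all pairs in [is_filling] reduce to consecutive cells. *)
Lemma compat_trans : transitive compat.
Proof.
move=> [[d1 d2] y] [[c1 c2] x] [[e1 e2] z] /and3P[/= lt_cd row_cd col_cd].
move=> /and3P[/= lt_de row_de col_de]; apply/and3P; split=> /=.
- exact: cell_lt_trans lt_de.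
- apply/implyP => /eqP eq_ce; subst e1.
  have /eqP eq_cd : c1 == d1.
    by move: lt_cd lt_de; rewrite /cell_lt /=; lia.
  by subst d1; rewrite eqxx in row_cd row_de; apply: rrow_trans row_de.
apply/implyP => /eqP eq_ce; subst e2.
have /eqP eq_cd : c2 == d2.
  by move: lt_cd lt_de; rewrite /cell_lt /=; lia.
by subst d2; rewrite eqxx in col_cd col_de; apply: rcol_trans col_cd.
Qed.

Lemma fil_path c x D w : path ribbon_step c D -> size w = size D ->
  fil rrow rcol x (pairmap step_of c D) w = path compat (c, x) (zip D w).
Proof.
elim: D c x w => [|d D IH] c x [|y w] //= /andP[cd pathD] [eq_sz].
rewrite IH //; congr (_ && _); rewrite /compat (ribbon_step_lt cd) /=.
move: cd; rewrite /step_of /ribbon_step; case: eqP => [-> _ /=|_].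
  by rewrite eqxx -[_ == _.+1]/(_ == _.+1)%N ltn_eqF ?andbT.
case: eqP => [-> _ /=|_ /= /andP[lt1 lt2]]; first by rewrite eqxx ltn_eqF.
by rewrite !ltn_eqF.
Qed.

Lemma is_filling_pairwise D w : pairwise cell_lt D -> size w = size D ->
  is_filling x0 rrow rcol D w = pairwise compat (zip D w).
Proof.
move=> ltD eq_sz.
have uniqD : uniq D by apply: pairwise_uniq ltD; apply: cell_lt_irr.
pose c0 : cell := (0, 0)%N.
have {ltD} ltD i j : (i < j)%N -> (j < size D)%N -> cell_lt (nth c0 D i) (nth c0 D j).
  move=> lt_ij lt_j; move/(pairwiseP c0): ltD; apply; rewrite ?inE //.
  exact: ltn_trans lt_j.
rewrite /is_filling eq_sz eqxx /=; apply/idP/idP => [filD | /(pairwiseP (c0, x0)) filD].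
  apply/(pairwiseP (c0, x0)) => i j; rewrite !inE !size_zip eq_sz minnn => lt_i lt_j lt_ij.
  rewrite !nth_zip //= /compat /= ltD //=.
  have in_D k : (k < size D)%N -> nth c0 D k \in D by move=> ?; apply: mem_nth.
  have /and3P[le1 le2 neq] := ltD _ _ lt_ij lt_j.
  apply/andP; split; apply/implyP => /eqP eq_ij.
    have /allP/(_ _ (in_D _ lt_j))/andP[+ _] := allP filD _ (in_D _ lt_i).
    rewrite !index_uniq // eq_ij eqxx /= => /implyP; apply.
    by move: neq; rewrite -pair_eqE /= eq_ij eqxx /=; lia.
  have /allP/(_ _ (in_D _ lt_i))/andP[_] := allP filD _ (in_D _ lt_j).
  rewrite !index_uniq // eq_ij eqxx /= => /implyP; apply.
  by move: neq; rewrite -pair_eqE /= eq_ij eqxx /=; lia.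
have {}filD i j : (i < j)%N -> (j < size D)%N ->
    compat (nth c0 D i, nth x0 w i) (nth c0 D j, nth x0 w j).
  move=> lt_ij lt_j; rewrite -!nth_zip //; apply: filD => //.
    by rewrite inE size_zip eq_sz minnn (ltn_trans lt_ij).
  by rewrite inE size_zip eq_sz minnn.
apply/(all_nthP c0) => i lt_i; apply/(all_nthP c0) => j lt_j.
rewrite !index_uniq //.
have [lt_ij | lt_ji | ->] := ltngtP i j; last by rewrite !ltnn !andbF.
- have /and3P[/and3P[/= le1 le2 _] row col] := filD _ _ lt_ij lt_j.
  apply/andP; split; first by apply/implyP => /andP[/(implyP row)].
  by apply/implyP => /andP[_]; rewrite ltnNge le1.
have /and3P[/and3P[/= le1 le2 _] row col] := filD _ _ lt_ji lt_i.
apply/andP; split; first by apply/implyP => /andP[_]; rewrite ltnNge le2.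
by apply/implyP => /andP[]; rewrite eq_sym => /(implyP col).
Qed.

Lemma is_filling_fil D x w : sorted ribbon_step D ->
  is_filling x0 rrow rcol D w = fil rrow rcol x (enc D) w.
Proof.
move=> sortedD; have [eq_sz | neq_sz] := eqVneq (size w) (size D); last first.
  rewrite /is_filling (negPf neq_sz) /=; apply/esym/negbTE.
  apply: contra neq_sz => fil_w; rewrite (fil_size fil_w).
  by case: (D) => //= c D1; rewrite size_pairmap.
rewrite is_filling_pairwise //; last first.
  rewrite -(sorted_pairwise cell_lt_trans).
  exact: sub_sorted ribbon_step_lt _ sortedD.
rewrite -(sorted_pairwise compat_trans).
case: D w sortedD eq_sz => [|c D] [|y w] //= pathD [eq_sz].
by rewrite fil_path.
Qed.

End FillingPath.

(** * Compositions and components *)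

Lemma realize_gschur_enc D x w :
  realize (gschur (enc D)) w = (sfil x (enc D) w)%:R.
Proof.
case: D => [|c D]; last exact: realize_gschur.
by rewrite [gschur _]/= realize1; case: w.
Qed.

Lemma sNSym_gschur D : sorted ribbon_step D -> sNSym D = gschur (enc D).
Proof.
move=> sortedD; apply: sNSym_eq => w; rewrite (realize_gschur_enc D 0).
rewrite /s_series (is_filling_fil _ _ _ 0) //; first exact: le_trans.
exact: lt_trans.
Qed.

(** The letter [e] enters the first cell: [Jump] for a new component, [Up] for a further row. *)
Fixpoint cenc (e : step) (a : composition) : seq step :=
  if a is k :: a' then e :: nseq (val k).-1 Right ++ cenc Up a' else [::].

Definition genc (g : seq composition) : seq step := flatten [seq cenc Jump a | a <- g].

Definition nojump (s : seq step) : bool :=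
  all (fun e => if e is Jump then false else true) s.

Lemma nojump_nseq n : nojump (nseq n Right).
Proof. by elim: n. Qed.

Lemma nojump_cenc a : nojump (cenc Up a).
Proof. by elim: a => //= k a IH; rewrite /nojump all_cat -!/(nojump _) nojump_nseq. Qed.

Lemma nojump_sorted D : nojump (behead (enc D)) -> sorted ribbon_step D.
Proof.
case: D => // c D; rewrite [behead _]/= [sorted _ _]/=.
elim: D c => //= d D IH c /andP[cd /IH->]; rewrite andbT.
by move: cd; rewrite /step_of /ribbon_step; case: eqP => // _; case: eqP.
Qed.

Lemma step_of_up r c : step_of (r, c) (r.+1, c) = Up.
Proof.
by rewrite /step_of eqxx; case: eqP => //= -[]; lia.
Qed.

Lemma enc_row c r n :
  pairmap step_of (r, c) [seq (r, i) | i <- iota c.+1 n] = nseq n Right.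
Proof. by elim: n c => //= n IH c; rewrite IH /step_of eqxx. Qed.

Lemma last_row (c r n : nat) :
  last (r, c) [seq (r, i) | i <- iota c.+1 n] = (r, c + n)%N.
Proof. by elim: n c => [|n IH] c /=; rewrite ?addn0 // IH addSnnS. Qed.

Lemma enc_ribbon_from p r c a :
  pairmap step_of p (ribbon_from r c a) = cenc (step_of p (r, c)) a.
Proof.
elim: a p r c => // -[[//|k] k_gt0] a IH p r c /=.
by rewrite pairmap_cat enc_row last_row IH step_of_up.
Qed.

Lemma enc_ribbon a : enc (ribbon a) = cenc Jump a.
Proof.
case: a => // -[[//|k] k_gt0] a /=.
by rewrite pairmap_cat enc_row last_row enc_ribbon_from step_of_up.
Qed.

Lemma nojump_ribbon a : nojump (behead (enc (ribbon a))).
Proof.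
rewrite enc_ribbon; case: a => //= k a.
by rewrite /nojump all_cat -!/(nojump _) nojump_nseq nojump_cenc.
Qed.

Lemma sNSym_ribbon a : sNSym (ribbon a) = gschur (cenc Jump a).
Proof. by rewrite sNSym_gschur ?enc_ribbon //; apply/nojump_sorted/nojump_ribbon. Qed.

(** Valid for every diagram, because [components] and [step_of] make the same case distinction. *)
Lemma enc_components D :
  [::] \notin components D /\ enc D = genc (components D).
Proof.
elim: D => // c [|d D] // [IH0 IH].
rewrite [components _]/= -/(components (d :: D)) [enc _]/=.
move: IH0 IH; case: (components (d :: D)) => [|[|k a] g] //.
rewrite in_cons => /norP[_ g0] [->]; rewrite /step_of.
case: ifP => _; last case: ifP => _; rewrite !in_cons /= (negPf g0); split=> //.
by case: k => [[|k] k_gt0].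
Qed.

Lemma cenc_cons e k b : cenc e (k :: b) = e :: nseq (val k).-1 Right ++ cenc Up b.
Proof. by []. Qed.

Lemma cenc_cat e k b c :
  cenc e ((k :: b) ++ c) = cenc e (k :: b) ++ cenc Up c.
Proof.
elim: b e k => [|l b IH] e k; first by rewrite /= cats0.
by rewrite cat_cons (cenc_cons e k (l :: b)) [RHS]cat_cons -catA -IH.
Qed.

(** Compared with concatenation, only the letter at the junction changes, from [Up] to [Right]. *)
Lemma cenc_nearcat e k b l c :
  cenc e (nearcat (k :: b) (l :: c))
    = cenc e (k :: b) ++ Right :: behead (cenc Up (l :: c)).
Proof.
elim: b e k => [|m b IH] e k.
  case: k l => [[//|k] k_gt0] [[//|l] l_gt0].
  by rewrite [nearcat _ _]/= !cenc_cons cats0 [(val _).-1]/(k + l.+1)%N nseqD -catA.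
by rewrite (cenc_cons e k (m :: b)) [RHS]cat_cons -catA -IH.
Qed.

Lemma gschur_cat_glue a b : a != [::] -> b != [::] ->
  gschur (cenc Jump (a ++ b)) + gschur (cenc Jump (nearcat a b))
    = gschur (cenc Jump a) * gschur (cenc Jump b).
Proof.
case: a b => [|k a] [|l b] // _ _.
by rewrite cenc_cat cenc_nearcat addrC; apply: gschur_glue.
Qed.

Lemma nearcat_rcons a k l b :
  nearcat (rcons a k) (l :: b) = a ++ addp k l :: b.
Proof. by elim: a => // x [|y a] //= ->. Qed.

Lemma cat_injl (T : Type) (a b c d : seq T) :
  size c = size d -> a ++ c = b ++ d -> a = b /\ c = d.
Proof.
move=> eq_sz eq_cat.
have eq_ab : size a = size b.
  by move/(congr1 size)/eqP: eq_cat; rewrite !size_cat eq_sz eqn_add2r => /eqP.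
by split; [move/(congr1 (take (size a))): eq_cat | move/(congr1 (drop (size a))): eq_cat];
   rewrite ?take_size_cat ?drop_size_cat // eq_ab ?take_size_cat ?drop_size_cat.
Qed.

Lemma addp_neq k l : addp k l <> l.
Proof. by move/(congr1 val); case: k => [[|k] k_gt0] //= eq_kl; lia. Qed.

Lemma nearcat_injl a b c : a != [::] -> b != [::] -> c != [::] ->
  nearcat a c = nearcat b c -> a = b.
Proof.
case/lastP: a => // a k _; case/lastP: b => // b l _; case: c => // m c _.
by rewrite !nearcat_rcons => /cat_injl[// | -> [/addIn/val_inj ->]].
Qed.

(** Near-concatenation enlarges the first part of [c], so the suffixes of length [size c] differ. *)
Lemma cat_neq_nearcat a b c : a != [::] -> b != [::] -> c != [::] ->
  a ++ c <> nearcat b c.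
Proof.
move=> _; case/lastP: b => // b l _; case: c => // m c _.
by rewrite nearcat_rcons => /cat_injl[// | _ [/esym]]; apply: addp_neq.
Qed.

Lemma nearcat_neq0 a b : a != [::] -> nearcat a b != [::].
Proof. by case: a b => [|k [|l a]] [|m b]. Qed.

(** * Classes of generalized ribbons and fundamental functionals *)

Section Rclass.
Local Open Scope fset_scope.

Definition rclass_step (B : {fset composition}) (c : composition) :=
  [fset b ++ c | b in B] `|` [fset nearcat b c | b in B].

Lemma rclass_step_neq0 B c :
  [::] \notin B -> [::] \notin rclass_step B c.
Proof.
move=> B0; rewrite inE; apply/norP; split; apply/imfsetP => -[b /= b_B eq_b].
  by case: b b_B eq_b B0 => // ->.
by have := @nearcat_neq0 b c; rewrite -eq_b; case: eqP b_B B0 => [-> ->|_ _ _ /(_ isT)].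
Qed.

(** The two images are disjoint and both maps injective, so the set loses no term of the product
    rule. With an empty factor the two operations would coincide. *)
Lemma sum_rclass_step (B : {fset composition}) c : [::] \notin B -> c != [::] ->
  \sum_(b <- rclass_step B c) gschur (cenc Jump b)
    = (\sum_(b <- B) gschur (cenc Jump b)) * gschur (cenc Jump c).
Proof.
move=> B0 c0.
have neq0 b : b \in (B : seq composition) -> b != [::].
  by move=> b_B; apply: contraNneq B0 => <-.
rewrite (perm_big ([seq b ++ c | b <- B] ++ [seq nearcat b c | b <- B])); last first.
  apply: uniq_perm => [| |b]; first exact: fset_uniq.
    rewrite cat_uniq !map_inj_in_uniq ?fset_uniq ?andbT /=.
    - apply/hasPn => _ /mapP[b b_B ->]; apply/mapP => -[a a_B /esym].
      by apply: cat_neq_nearcat => //; apply: neq0.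
    - by move=> a b a_B b_B; apply: nearcat_injl => //; apply: neq0.
    - by move=> a b _ _ /cat_injl[].
  rewrite mem_cat inE; congr (_ || _).
    by apply/imfsetP/mapP => -[a a_B ->]; exists a.
  by apply/imfsetP/mapP => -[a a_B ->]; exists a.
rewrite big_cat !big_map /= -big_split mulr_suml big_seq [RHS]big_seq.
by apply: eq_bigr => b b_B; apply: gschur_cat_glue => //; apply: neq0.
Qed.

End Rclass.

Lemma gschur_cat_genc s g : [::] \notin g ->
  gschur (s ++ genc g) = gschur s * gschur (genc g).
Proof.
case: g => [|[|k a] g] // _; first by rewrite cats0 mulr1.
exact: gschur_jump.
Qed.

Lemma gschur_genc g : [::] \notin g ->
  gschur (genc g) = \sum_(b <- rclass g) gschur (cenc Jump b).
Proof.
case: g => [|a g]; first by rewrite big_seq_fset1.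
rewrite in_cons => /norP[a0 g0].
rewrite -[genc _]/(cenc Jump a ++ genc g) gschur_cat_genc //.
rewrite -[rclass _]/(foldl rclass_step [fset a]%fset g).
have -> : gschur (cenc Jump a) = \sum_(b <- [fset a]%fset) gschur (cenc Jump b).
  by rewrite big_seq_fset1.
have: [::] \notin [fset a]%fset by rewrite inE.
(* [rclass] is a left fold, so the set accumulated so far is generalized. *)
move: [fset a]%fset => B; elim: g g0 B => [|c g IH] g0 B B0 /=.
  by rewrite mulr1.
move: g0; rewrite in_cons => /norP[c0 g0].
rewrite -[RHS](IH g0 _ (rclass_step_neq0 c B0)).
rewrite (sum_rclass_step B0); last by rewrite eq_sym.
by rewrite -mulrA -(gschur_cat_genc _ g0).
Qed.

Lemma sNSym_rclass D : sorted ribbon_step D ->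
  sNSym D = \sum_(b <- rclass (components D)) sNSym (ribbon b).
Proof.
move=> sortedD; have [comp0 enc_comp] := enc_components D.
rewrite sNSym_gschur // enc_comp gschur_genc //.
by apply: eq_bigr => b _; rewrite sNSym_ribbon.
Qed.

(** The first letter is one less than [size b], so the bound on [x] gives the strict descent that
    entry by [Up] demands. *)
Lemma fil_descword e x b : (size b)%:Z <= x -> e <> Right -> sfil x (cenc e b) (descword b).
Proof.
elim: b e x => // -[[//|k] k_gt0] b IH e x le_bx eR.
rewrite [cenc _ _]/= [descword _]/= [sfil _ _ _]/=.
rewrite -!/(fil _ _) fil_cat ?size_nseq // fil_nseq size_nseq eqxx.
rewrite last_nseq IH // andbT; apply/andP; split.
  by case: e eR => //= _; apply: lt_le_trans le_bx; rewrite ltz_nat.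
by have := sorted_nseq k.+1 (size b)%:Z.
Qed.

(** Weak ascents and strict descents exclude each other, so any filling determines a step word
    without jumps. *)
Lemma fil_steps s y w : nojump s -> sfil y s w ->
  s = pairmap (fun u v => if u <= v then Right else Up) y w.
Proof.
elim: s y w => [|[] s IH] y [|z w] //= js /andP[yz /(IH _ _ js) <-].
  by rewrite yz.
by rewrite leNgt yz.
Qed.

Lemma cenc_inj i j a b :
  nseq i Right ++ cenc Up a = nseq j Right ++ cenc Up b -> i = j /\ a = b.
Proof.
elim: a b i j => [|k a IH] b i j.
  elim: i j => [|i IHi] [|j] //=; last by move=> [] /IHi[-> ->].
    by case: b.
  by case: b {IHi}.
elim: i j => [|i IHi] [|j] //=; last by move=> [] /IHi[-> ->].
  case: b => [|l b] // [] /IH[eq_kl ->]; split=> //; congr (_ :: _).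
  by apply: val_inj; move: eq_kl (valP k) (valP l) => /=; lia.
by case: b {IHi}.
Qed.

(** [descword b] fills the ribbon of [b]; if it also fills that of [a], then [fil_steps] equates the
    step words and [cenc_inj] the compositions. *)
Lemma s_ribbon_descword a b :
  s_series (ribbon a) (descword b) = (a == b)%:R.
Proof.
rewrite /s_series (is_filling_fil _ _ _ 0); first last.
- exact/nojump_sorted/nojump_ribbon.
- exact: lt_trans.
- exact: le_trans.
rewrite enc_ribbon; congr (nat_of_bool _)%:R; apply/idP/eqP => [fil_a | ->]; last first.
  case: b => // k b; have := @fil_descword Jump (size (k :: b)) (k :: b) (lexx _).
  by apply.
have fil_b : sfil 0 (cenc Jump b) (descword b).
  case: b {fil_a} => // k b; have := @fil_descword Jump (size (k :: b)) (k :: b) (lexx _).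
  by apply.
case: a b fil_a fil_b => [|k a] [|l b] //; first by case: l => [[|l] l_gt0].
case: (descword _) => // y w /andP[_ fil_a] /andP[_ fil_b].
have jump c n : nojump (nseq n Right ++ cenc Up c).
  by rewrite /nojump all_cat -!/(nojump _) nojump_nseq nojump_cenc.
move: (fil_steps (jump _ _) fil_a); rewrite -(fil_steps (jump _ _) fil_b).
case/cenc_inj => eq_kl ->; congr (_ :: _).
by apply: val_inj; move: eq_kl (valP k) (valP l) => /=; lia.
Qed.

Lemma Ffun_ribbon b a : Ffun b (sNSym (ribbon a)) = (a == b)%:R.
Proof.
(* Taking the coefficient at [descword b] shows that the specification inside [Ffun] can be met. *)
pose ev : {additive NSym -> int} :=
  mmap (idfun : {additive int -> int}) (fun m : word => hprod m (descword b)).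
pose spec (f : {additive NSym -> int}) :=
  forall a : composition, f (sNSym (ribbon a)) = (a == b)%:R.
suff evP : spec ev by apply: (epsilon_spec _ spec (ex_intro _ ev evP)).
move=> c; rewrite sNSym_ribbon -enc_ribbon.
rewrite -s_ribbon_descword -[LHS]/(realize _ (descword b)) (realize_gschur_enc _ 0).
rewrite /s_series (is_filling_fil _ _ _ 0) //.
- exact: le_trans.
- exact: lt_trans.
- exact/nojump_sorted/nojump_ribbon.
Qed.

Lemma Ffun_gschur b D : sorted ribbon_step D ->
  Ffun b (gschur (enc D)) = (b \in rclass (components D))%:R.
Proof.
move=> sortedD; rewrite -sNSym_gschur // sNSym_rclass // raddf_sum /=.
under eq_bigr do rewrite Ffun_ribbon.
have [b_D | b_D] := boolP (b \in _).
  rewrite (bigD1_seq b) ?fset_uniq //= eqxx big1 ?addr0 // => a.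
  by move/negPf->.
rewrite big_seq big1 // => a a_D; case: eqP => // eq_ab.
by rewrite -eq_ab a_D in b_D.
Qed.

(** * The two parts of a decomposition *)

(* The step word of the part of colour [b] in the two-colouring [t] of the
   diagram with step word [s]; [x] is the colour of the cell before the first. *)
Fixpoint part (b x : bool) (s : seq step) (t : seq bool) : seq step :=
  match s, t with
  | e :: s', y :: t' =>
    if y == b then (if x == b then e else Jump) :: part b y s' t' else part b y s' t'
  | _, _ => [::]
  end.

Notation bfil := (fil implb implb).

Lemma implb_trans : transitive implb.
Proof. by case=> [] [] []. Qed.

Lemma step_of_gap c d :
  (c.1 + c.2 + 1 < d.1 + d.2)%N -> step_of c d = Jump.
Proof.
case: c d => [r c] [r' c'] /= lt_cd; rewrite /step_of.
by case: eqP => [[? ?]|_]; last case: eqP => [[? ?]|_] //; subst=> /=; lia.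
Qed.

Lemma step_of_content c d : nojump [:: step_of c d] ->
  (d.1 + d.2 = c.1 + c.2 + 1)%N.
Proof.
rewrite /step_of; case: eqP => [-> _|_]; first by rewrite /=; lia.
by case: eqP => [-> _|_] //=; lia.
Qed.

(** Each step of a ribbon raises the sum of row and column by one, so leaving out a cell turns the
    step across it into a [Jump]. Here [x] is the colour of [c], and [c0] stands for the last cell
    kept before a gap. *)
Lemma enc_mask_path b c x D t :
  nojump (pairmap step_of c D) -> size t = size D ->
  let D' := mask [seq y == b | y <- t] D in
  let s := part b x (pairmap step_of c D) t in
  (x = b -> pairmap step_of c D' = s) /\
  (x != b -> enc D' = s /\
    forall c0, (c0.1 + c0.2 < c.1 + c.2)%N -> pairmap step_of c0 D' = s).
Proof.
elim: D c x t => [|d D IH] c x [|y t] //= /andP[cd jD] [eq_sz].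
have cnt := @step_of_content c d; rewrite /= cd in cnt; have {}cnt := cnt isT.
have [IHb IHnb] := IH d y t jD eq_sz.
case: (eqVneq y b) => [eq_yb | neq_yb] /=.
  rewrite {}IHb //; split=> [-> | /negPf->]; rewrite ?eqxx //; split=> // c0 lt_c0.
  by rewrite step_of_gap // cnt; lia.
have [encD gapD] := IHnb neq_yb; split=> _; first by apply: gapD; lia.
by split=> // c0 lt_c0; apply: gapD; lia.
Qed.

Lemma enc_mask b x D t : nojump (behead (enc D)) -> size t = size D ->
  enc (mask [seq y == b | y <- t] D) = part b x (enc D) t.
Proof.
case: D t => [|c D] [|y t] //= jD [eq_sz].
have [encb encnb] := enc_mask_path b y jD eq_sz.
case: (eqVneq y b) => [/encb | /encnb[]] /= -> //.
(* The first letter of [enc D] is [Jump], so the colour [x] before it is immaterial. *)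
by rewrite if_same.
Qed.

(* In a decomposition, a part is left horizontally and reentered vertically
   (for [false]), or conversely (for [true]), so that successive connected
   components are strictly northeast of each other. *)
Definition left_by (b : bool) (c d : cell) : bool :=
  if b then (c.1 < d.1)%N && (c.2 <= d.2)%N else (c.1 <= d.1)%N && (c.2 < d.2)%N.

(** Here the colouring must be a filling, for only then are the gaps in a part strictly
    northeast. *)
Lemma path_mask b c x D t :
  nojump (pairmap step_of c D) -> bfil x (pairmap step_of c D) t ->
  let D' := mask [seq y == b | y <- t] D in
  (x = b -> path ribbon_step c D') /\
  (x != b -> sorted ribbon_step D' /\
    forall c0, left_by b c0 c -> path ribbon_step c0 D').
Proof.
elim: D c x t => [|d D IH] c x [|y t] //= /andP[cd jD] /andP[xy fD].
have [IHb IHnb] := IH d y t jD fD.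
case: (eqVneq y b) => [eq_yb | neq_yb] /=; last first.
  have [sortedD pathD] := IHnb neq_yb; split=> [eq_xb|_].
    (* Along a filling, [false] turns into [true] only by [Right], and [true] into [false] only by
       [Up]. *)
    apply: pathD; move: cd xy neq_yb; rewrite -eq_xb /left_by /step_of.
    case: eqP => [-> | _]; last case: eqP => [-> | _] //=.
      by case: (x) (y) => [] [] //= _ _ _; lia.
    by case: (x) (y) => [] [] //= _ _ _; lia.
  split=> // c0 left_c; apply: pathD; move: cd left_c; rewrite /left_by /step_of.
  by case: eqP => [-> | _]; last case: eqP => [-> | _] //=; case: (b) => /=; lia.
have pathD := IHb eq_yb; split=> [_|neq_xb].
  rewrite pathD andbT; move: cd; rewrite /step_of /ribbon_step.
  by case: eqP => // _; case: eqP.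
split=> // c0 left_c; rewrite pathD andbT.
(* Reentry is strict in the coordinate in which [left_by] is weak, so the jump is strict in both. *)
apply/or3P; apply: Or33; move: cd xy neq_xb left_c; rewrite -eq_yb /left_by /step_of.
case: eqP => [-> | _]; last case: eqP => [-> | _] //=.
  by case: (x) (y) => [] [] //= _ _ _; lia.
by case: (x) (y) => [] [] //= _ _ _; lia.
Qed.

Lemma sorted_part b x D t : nojump (behead (enc D)) -> bfil x (enc D) t ->
  sorted ribbon_step (mask [seq y == b | y <- t] D).
Proof.
case: D t => [|c D] [|y t] //= jD fD.
have [encb encnb] := path_mask b jD fD.
by case: (eqVneq y b) => [/encb | /encnb[]].
Qed.

(** * Tensors and the coproduct *)

(* Locked, because the unification of two tensors unfolds [tens]. *)
Definition tensor (a b : NSym) : NSym2 := locked tens a b.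

Lemma tensorE a b : tens a b = tensor a b.
Proof. by rewrite /tensor -lock. Qed.

Lemma mcoeff_tens a b u v : (tensor a b)@_(u, v) = a@_u * b@_v.
Proof.
rewrite -tensorE /tens raddf_sum /= [in RHS](monalgE a) [in RHS](monalgE b).
rewrite !(raddf_sum (mcoeff _)) /= mulr_suml.
apply: eq_bigr => u' _; rewrite raddf_sum /= mulr_sumr; apply: eq_bigr => v' _.
by rewrite !mcoeffU mulrnAl mulrnAr -mulrnA mulnb andbC.
Qed.

Lemma tensBl a b c : tensor (a - b) c = tensor a c - tensor b c.
Proof.
have := fun k => mcoeffB k a b; move: (a - b) => d dE.
by apply/malgP => -[u v]; rewrite mcoeffB 3!mcoeff_tens dE mulrBl.
Qed.

Lemma tensBr a b c : tensor a (b - c) = tensor a b - tensor a c.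
Proof.
have := fun k => mcoeffB k b c; move: (b - c) => d dE.
by apply/malgP => -[u v]; rewrite mcoeffB 3!mcoeff_tens dE mulrBr.
Qed.

Lemma tens0l a : tensor 0 a = 0.
Proof. by rewrite -[0](subrr a) tensBl subrr. Qed.

Lemma tens0r a : tensor a 0 = 0.
Proof. by rewrite -[0](subrr a) tensBr subrr. Qed.

Lemma tensDl a b c : tensor (a + b) c = tensor a c + tensor b c.
Proof. by rewrite -{1}[b]opprK tensBl -(sub0r b) tensBl tens0l sub0r opprK. Qed.

Lemma tensDr a b c : tensor a (b + c) = tensor a b + tensor a c.
Proof. by rewrite -{1}[c]opprK tensBr -(sub0r c) tensBr tens0r sub0r opprK. Qed.

Lemma tensUU u v : tensor << u >> << v >> = << (u, v) >>.
Proof.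
apply/malgP => -[u' v']; rewrite mcoeff_tens !mcoeffU1 -natrM mulnb.
by rewrite -[in RHS]pair_eqE.
Qed.

Lemma tens11 : tensor 1 1 = 1.
Proof. exact: tensUU. Qed.

(** Both sides are additive in each of the four arguments, which leaves basis words. *)
Lemma tensM a b c d : tensor (a * b) (c * d) = tensor a c * tensor b d.
Proof.
move: a; apply: malg_ind.
- by rewrite mul0r !tens0l mul0r.
- move=> x y IHx IHy; rewrite (mulrBl b x y) (tensBl (x * b)) (tensBl x) [RHS]mulrBl.
  by congr (_ - _); [apply: IHx | apply: IHy].
move=> u; move: b; apply: malg_ind.
- by rewrite mulr0 !tens0l mulr0.
- move=> x y IHx IHy; rewrite (mulrBr _ x y) (tensBl (_ * x)) (tensBl x) [RHS]mulrBr.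
  by congr (_ - _); [apply: IHx | apply: IHy].
move=> u'; move: c; apply: malg_ind.
- by rewrite mul0r !tens0r mul0r.
- move=> x y IHx IHy; rewrite (mulrBl d x y) (tensBr _ (x * d)) (tensBr _ x) [RHS]mulrBl.
  by congr (_ - _); [apply: IHx | apply: IHy].
move=> v; move: d; apply: malg_ind.
- by rewrite mulr0 !tens0r mulr0.
- move=> x y IHx IHy; rewrite (mulrBr _ x y) (tensBr _ (_ * x)) (tensBr _ x) [RHS]mulrBr.
  by congr (_ - _); [apply: IHx | apply: IHy].
move=> v'; rewrite (mulUU u) (mulUU v) tensUU (tensUU u v) (tensUU u' v').
by rewrite malgM_def fgmulUU mulr1.
Qed.

Lemma coprodB a b : coprod (a - b) = coprod a - coprod b.
Proof. exact: (mmapB (f := intmul 1 : {additive int -> NSym2})). Qed.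

Lemma coprod0 : coprod 0 = 0.
Proof. by rewrite -[0](subrr (0 : NSym)) coprodB subrr. Qed.

Definition coprod_h (n : nat) : NSym2 := \sum_(i < n.+1) tensor (hNSym i) (hNSym (n - i)).

Lemma coprodU (m : word) : coprod << m >> = \prod_(k <- m) coprod_h (val k).
Proof.
rewrite [LHS](mmapU (f := intmul 1 : {additive int -> NSym2})) mul1r.
by apply: eq_bigr => k _; apply: eq_bigr => i _; rewrite tensorE.
Qed.

Lemma coprod1 : coprod 1 = 1.
Proof. by rewrite coprodU fm1 big_nil. Qed.

Lemma coprod_hM n u : coprod (hNSym n.+1 * u) = coprod_h n.+1 * coprod u.
Proof.
move: u; apply: malg_ind.
- by rewrite mulr0 coprod0 mulr0.
- move=> x y IHx IHy; rewrite (mulrBr (hNSym n.+1)) coprodB (coprodB x) [RHS]mulrBr.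
  by congr (_ - _); [apply: IHx | apply: IHy].
by move=> m; rewrite hNSymS mulUU coprodU (coprodU m) fmM fmU big_cons.
Qed.

Lemma coprod_hNSym n : coprod (hNSym n.+1) = coprod_h n.+1.
Proof. by rewrite -[hNSym _]mulr1 coprod_hM coprod1 mulr1. Qed.

(** Plain sequences replace tuples here, so that sums over colourings split along a concatenation
    without length casts. *)
Fixpoint words (n : nat) : seq (seq bool) :=
  if n is n'.+1 then map (cons false) (words n') ++ map (cons true) (words n')
  else [:: [::]].

Lemma mem_words n t : (t \in words n) = (size t == n).
Proof.
have inj b : injective (cons b : seq bool -> _) by move=> u v [].
elim: n t => [|n IH] [|[] t] //=; rewrite ?mem_cat.
- by apply/negbTE/norP; split; apply/mapP => -[].
- rewrite orbC mem_map // IH; case: mapP => [[] //|_].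
  by rewrite orbF.
- rewrite mem_map // IH; case: mapP => [[] //|_].
  by rewrite orbF.
Qed.

Lemma uniq_words n : uniq (words n).
Proof.
have inj b : injective (cons b : seq bool -> _) by move=> u v [].
elim: n => //= n IH; rewrite cat_uniq !map_inj_uniq ?IH //= andbT.
by apply/hasPn => _ /mapP[u _ ->]; apply/mapP => -[].
Qed.

Section WordSums.
Variables (V : zmodType).
Implicit Types (F : seq bool -> V).

Lemma big_tuple_words n (P : pred (seq bool)) F :
  \sum_(t : n.-tuple bool | P t) F t = \sum_(t <- words n | P t) F t.
Proof.
rewrite -(big_map val P F); apply/perm_big/uniq_perm.
- by rewrite map_inj_uniq ?index_enum_uniq //; apply: val_inj.
- exact: uniq_words.
move=> t; rewrite mem_words; apply/mapP/idP => [[u _ ->] | size_t].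
  by rewrite size_tuple.
by exists (Tuple size_t); rewrite ?mem_index_enum.
Qed.

Lemma big_words_cat m n F :
  \sum_(t <- words (m + n)) F t
    = \sum_(u <- words m) \sum_(v <- words n) F (u ++ v).
Proof.
elim: m F => [|m IH] F /=; first by rewrite big_seq1.
by rewrite !big_cat !big_map /= !(IH (fun t => F (_ :: t))).
Qed.

(** A weakly increasing colouring of a row is determined by the place where [false] changes to
    [true]. *)
Lemma big_words_row n F :
  \sum_(t <- words n | bfil false (nseq n Right) t) F t
    = \sum_(i < n.+1) F (nseq i false ++ nseq (n - i) true).
Proof.
have fil_true m G : \sum_(t <- words m | bfil true (nseq m Right) t) G t
    = G (nseq m true) :> V.
  elim: m G => [|m IH] G /=; first by rewrite big_cons big_nil addr0.
  by rewrite big_cat !big_map /= big_pred0_eq add0r IH.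
elim: n F => [|n IH] F /=; first by rewrite big_cons big_nil big_ord_recl big_ord0.
by rewrite big_cat !big_map /= IH fil_true addrC [RHS]big_ord_recl.
Qed.

End WordSums.

(** * Coproduct of a ribbon *)

Lemma part_cat b x s1 s2 t1 t2 : size s1 = size t1 ->
  part b x (s1 ++ s2) (t1 ++ t2) = part b x s1 t1 ++ part b (last x t1) s2 t2.
Proof.
elim: s1 t1 x => [|e s1 IH] [|y t1] x //= [eq_sz].
by rewrite IH //; case: (y == b).
Qed.

(** After a cell of the other colour, the first letter of the part, if any, is a [Jump]. *)
Lemma gschur_part_gap b x u s t : x != b ->
  gschur (u ++ part b x s t) = gschur u * gschur (part b x s t).
Proof.
elim: s t x => [|e s IH] [|y t] x neq_xb; rewrite ?cats0 ?mulr1 //=.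
case: (eqVneq y b) => [_ | /IH-> //]; rewrite (negPf neq_xb).
exact: gschur_jump.
Qed.

Lemma part_neq0 b x s t : b \in t -> size s = size t -> ~~ nilp (part b x s t).
Proof.
elim: s t x => [|e s IH] [|y t] x //=; rewrite in_cons eq_sym.
by case: (y == b) => //= b_t [eq_sz]; apply: IH.
Qed.

Lemma part_all b s : part b b s (nseq (size s) b) = s.
Proof. by elim: s => //= e s ->; rewrite eqxx. Qed.

Lemma part_none b x s n : part b x s (nseq n (~~ b)) = [::].
Proof. by elim: s n x => [|e s IH] [|n] x //=; case: b IH => /= ->. Qed.

Lemma gschur_row n : gschur (Jump :: nseq n Right) = hNSym n.+1.
Proof.
rewrite [gschur _]/= -[n in RHS]add0n; elim: n 0%N => [|n IH] j /=.
  by rewrite addn0.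
by rewrite IH addSnnS.
Qed.

Lemma hNSym0 : hNSym 0 = 1.
Proof. by rewrite /hNSym insubF. Qed.

Lemma gschur_part_row b x n :
  x != b -> gschur (part b x (nseq n Right) (nseq n b)) = hNSym n.
Proof.
case: n => [|n] neq_xb; first by rewrite hNSym0.
rewrite [part _ _ _ _]/= eqxx (negPf neq_xb).
by have := part_all b (nseq n Right); rewrite size_nseq => ->; apply: gschur_row.
Qed.

Definition decomp_term (s : seq step) (t : seq bool) : NSym2 :=
  tensor (gschur (part false false s t)) (gschur (part true false s t)).

Definition decomp_sum (s : seq step) : NSym2 :=
  \sum_(t <- words (size s) | bfil false s t) decomp_term s t.

Lemma decomp_sum_row n : decomp_sum (Jump :: nseq n Right) = coprod_h n.+1.
Proof.
(* Any colour may follow [false] in a row, so the initial [Jump] can be read as a [Right]. *)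
rewrite /decomp_sum [size _]/= size_nseq (eq_bigl (bfil false (nseq n.+1 Right))); last first.
  by case.
rewrite big_words_row; apply: eq_bigr => i _; rewrite /decomp_term.
have row b t : part b false (Jump :: nseq n Right) t = part b (~~ b) (nseq n.+1 Right) t.
  by case: t => //= y t; case: b y => [] [].
have le_i : (i <= n.+1)%N by rewrite -ltnS.
rewrite !row.
have -> : nseq n.+1 Right = nseq i Right ++ nseq (n.+1 - i) Right.
  by rewrite -nseqD subnKC.
rewrite !part_cat ?size_nseq // !last_nseq (part_none false) (part_none true) cats0.
by rewrite !gschur_part_row.
Qed.

Lemma decomp_glue_term A s u v : size u = size A -> u != [::] -> size v = (size s).+1 ->
  (if bfil false (A ++ Right :: s) (u ++ v)
     then decomp_term (A ++ Right :: s) (u ++ v) else 0)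
  + (if bfil false (A ++ Up :: s) (u ++ v)
     then decomp_term (A ++ Up :: s) (u ++ v) else 0)
  = (if bfil false A u then decomp_term A u else 0)
    * (if bfil false (Jump :: s) v then decomp_term (Jump :: s) v else 0).
Proof.
move=> eq_sz u0; case: v => // y v _; rewrite !fil_cat //.
case: (bfil false A u); last by rewrite mul0r addr0.
rewrite !andTb [bfil _ (Jump :: s) _]/= [bfil _ (Right :: s) _]/= [bfil _ (Up :: s) _]/=.
case: (bfil y s v); last by rewrite !andbF mulr0 addr0.
rewrite !andbT /decomp_term !part_cat //; set x := last false u.
pose p b := gschur (part b false A u); pose q b := gschur (part b false (Jump :: s) (y :: v)).
pose g b e := gschur (part b false A u ++ part b x (e :: s) (y :: v)).
(* Unless both cells at the junction have colour [b], the part of colour [b] is disconnected there,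
   whatever the letter [e]. *)
have gap b e : (x != b) || (y != b) -> g b e = p b * q b.
  rewrite /g /p /q /=; case: (eqVneq y b) => [_ | neq_yb _].
    by rewrite orbF => /negPf->; rewrite if_same; apply: gschur_jump.
  exact: gschur_part_gap.
have glue b : x = b -> y = b -> g b Right + g b Up = p b * q b.
  move=> xb yb; rewrite /g /p /q /= xb yb eqxx if_same.
  (* [gschur_glue] needs a nonempty left factor; the last cell of [A] provides one. *)
  have b_u : b \in u by rewrite -xb /x; case: (u) u0 => //= z w _; apply: mem_last.
  move: (part_neq0 false b_u (esym eq_sz)); case: (part b false A u) => // e w _.
  exact: gschur_glue.
rewrite -/(g false Right) -/(g true Right) -/(g false Up) -/(g true Up).
rewrite -/(p false) -/(p true) -/(q false) -/(q true) -tensM.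
(* Equal colours allow both letters at the junction; [true] then [false] allows only [Up], and
   [false] then [true] only [Right]. *)
clearbody g p q x; case: x y gap glue => [] [] gap glue /=.
- by rewrite !(gap false) // -tensDr glue.
- by rewrite !gap // add0r.
- by rewrite !gap // addr0.
- by rewrite !(gap true) // -tensDl glue.
Qed.

Lemma decomp_sumE s :
  decomp_sum s
    = \sum_(t <- words (size s)) if bfil false s t then decomp_term s t else 0.
Proof. exact: big_mkcond. Qed.

Lemma decomp_sum_cat s1 s2 :
  decomp_sum (s1 ++ s2)
    = \sum_(u <- words (size s1)) \sum_(v <- words (size s2))
        if bfil false (s1 ++ s2) (u ++ v) then decomp_term (s1 ++ s2) (u ++ v) else 0.
Proof. by rewrite decomp_sumE size_cat big_words_cat. Qed.

Lemma decomp_sum_glue e A s :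
  decomp_sum (e :: A ++ Right :: s) + decomp_sum (e :: A ++ Up :: s)
    = decomp_sum (e :: A) * decomp_sum (Jump :: s).
Proof.
rewrite -!cat_cons !decomp_sum_cat (decomp_sumE (e :: A)) (decomp_sumE (Jump :: s)).
rewrite -big_split mulr_suml big_seq [RHS]big_seq.
apply: eq_bigr => u; rewrite mem_words => /eqP size_u.
rewrite -[LHS]big_split mulr_sumr big_seq [RHS]big_seq.
apply: eq_bigr => v; rewrite mem_words => /eqP size_v.
by apply: (decomp_glue_term size_u) => //; rewrite -size_eq0 size_u.
Qed.

(** Both sides agree on a single row, and [decomp_sum_glue] matches the recursion of [gval] at
    [Up]. *)
Lemma coprod_gval j s : nojump s ->
  coprod (gval j s) = decomp_sum (Jump :: nseq j Right ++ s).
Proof.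
elim: s j => [|[] s IH] j //= js.
- by rewrite cats0 coprod_hNSym -decomp_sum_row.
- by rewrite IH // -nseq_rcat.
rewrite coprodB coprod_hM !IH // -(decomp_sum_row j) -(decomp_sum_glue Jump) nseq_rcat.
by rewrite addrC addKr.
Qed.

(** * Skewing *)

Lemma size_enc D : size (enc D) = size D.
Proof. by case: D => //= c D; rewrite size_pairmap. Qed.

Lemma coprod_gschur_enc D : nojump (behead (enc D)) ->
  coprod (gschur (enc D)) = decomp_sum (enc D).
Proof.
case: D => [_|c D jD]; last exact: (coprod_gval 0 jD).
rewrite /decomp_sum big_cons big_nil addr0 /decomp_term.
by rewrite [gschur _]/= coprod1 tens11.
Qed.

Lemma is_decompE alpha t : is_decomp alpha t = bfil false (enc (ribbon alpha)) t.
Proof.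
apply: (is_filling_fil _ implb_trans implb_trans).
exact/nojump_sorted/nojump_ribbon.
Qed.

Lemma gpart_mask alpha t :
  gpart alpha t = mask [seq y == false | y <- t] (ribbon alpha).
Proof. by congr mask; apply: eq_map => -[]. Qed.

Lemma dpart_mask alpha t :
  dpart alpha t = mask [seq y == true | y <- t] (ribbon alpha).
Proof. by congr mask; rewrite -[LHS]map_id; apply: eq_map => -[]. Qed.

Lemma sorted_gpart alpha t : is_decomp alpha t -> sorted ribbon_step (gpart alpha t).
Proof.
rewrite is_decompE gpart_mask => dec_t.
exact: sorted_part (nojump_ribbon alpha) dec_t.
Qed.

Lemma sorted_dpart alpha t : is_decomp alpha t -> sorted ribbon_step (dpart alpha t).
Proof.
rewrite is_decompE dpart_mask => dec_t.
exact: sorted_part (nojump_ribbon alpha) dec_t.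
Qed.

Lemma coprod_ribbon alpha :
  coprod (sNSym (ribbon alpha))
    = \sum_(t | is_decomp alpha t) tensor (sNSym (gpart alpha t)) (sNSym (dpart alpha t)).
Proof.
rewrite sNSym_ribbon -enc_ribbon coprod_gschur_enc ?nojump_ribbon //.
rewrite /decomp_sum size_enc -big_tuple_words.
apply: eq_big => [t|t]; first by rewrite is_decompE.
rewrite -is_decompE => dec_t; rewrite /decomp_term.
rewrite !sNSym_gschur ?sorted_gpart ?sorted_dpart // gpart_mask dpart_mask.
by rewrite -!enc_mask ?nojump_ribbon ?size_tuple.
Qed.

(** * Cocommutativity of the coproduct *)

Definition swap (x : NSym2) : NSym2 :=
  mmap (intmul 1 : {additive int -> NSym2}) (fun p => << (p.2, p.1) >>) x.

Lemma swapB x y : swap (x - y) = swap x - swap y.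
Proof. exact: mmapB. Qed.

Lemma swap0 : swap 0 = 0.
Proof. exact: mmap0. Qed.

Lemma swapU u v : swap << (u, v) >> = << (v, u) >>.
Proof. by rewrite /swap mmapU mul1r. Qed.

Lemma mulUU2 (p q : (word * word)%type) :
  << p >> * << q >> = << (mmul p.1 q.1, mmul p.2 q.2) >> :> NSym2.
Proof. by rewrite malgM_def fgmulUU mulr1. Qed.

Lemma swapM x y : swap (x * y) = swap x * swap y.
Proof.
move: x; apply: malg_ind.
- by rewrite mul0r swap0 mul0r.
- move=> a b IHa IHb; rewrite (mulrBl y a b) (swapB (a * y)) (swapB a) [RHS]mulrBl.
  by congr (_ - _); [apply: IHa | apply: IHb].
move=> [u v]; move: y; apply: malg_ind.
- by rewrite mulr0 swap0 mulr0.
- move=> a b IHa IHb; rewrite (mulrBr _ a b) (swapB (_ * a)) (swapB a) [RHS]mulrBr.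
  by congr (_ - _); [apply: IHa | apply: IHb].
move=> [u' v']; apply: etrans (congr1 swap (mulUU2 (u, v) (u', v'))) _.
apply: etrans (swapU _ _) _; apply/esym.
apply: etrans (f_equal2 *%R (swapU u v) (swapU u' v')) _.
exact: (mulUU2 (v, u) (v', u')).
Qed.

Lemma swap_tens a b : swap (tensor a b) = tensor b a.
Proof.
move: a; apply: malg_ind.
- by rewrite tens0l tens0r swap0.
- move=> x y IHx IHy; rewrite tensBl (tensBr _ x) swapB.
  by congr (_ - _); [apply: IHx | apply: IHy].
move=> u; move: b; apply: malg_ind.
- by rewrite tens0l tens0r swap0.
- move=> x y IHx IHy; rewrite (tensBl x) (tensBr _ x) swapB.
  by congr (_ - _); [apply: IHx | apply: IHy].
by move=> v; rewrite tensUU swapU -tensUU.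
Qed.

Lemma swap_coprod_h n : swap (coprod_h n) = coprod_h n.
Proof.
rewrite /coprod_h (big_morph swap (id1 := 0) (op1 := +%R)); first last.
- exact: swap0.
- exact: mmapD.
rewrite [RHS](reindex_inj rev_ord_inj) /=; apply: eq_bigr => i _.
by rewrite swap_tens subSS subKn // -ltnS.
Qed.

(** [swap] is multiplicative, and on each generator it only reverses the order of summation. *)
Lemma swap_coprod a : swap (coprod a) = coprod a.
Proof.
move: a; apply: malg_ind.
- by rewrite coprod0 swap0.
- move=> x y IHx IHy; rewrite coprodB swapB.
  by congr (_ - _); [apply: IHx | apply: IHy].
move=> m; rewrite coprodU (big_morph swap (id1 := 1) (op1 := *%R)).
- by apply: eq_bigr => k _; apply: swap_coprod_h.
- exact: swapM.
- by rewrite -tens11 swap_tens.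
Qed.

Section Skew.
Variable f : {additive NSym -> int}.

(** The additive map id (x) [f] on the tensor square; its mirror image [contract_l] is [f] (x)
    id. *)
Definition contract_r (x : NSym2) : NSym :=
  mmap (intmul 1 : {additive int -> NSym}) (fun p => f << p.2 >> *: << p.1 >>) x.

Definition contract_l (x : NSym2) : NSym :=
  mmap (intmul 1 : {additive int -> NSym}) (fun p => f << p.1 >> *: << p.2 >>) x.

Lemma contract_rB x y : contract_r (x - y) = contract_r x - contract_r y.
Proof. exact: mmapB. Qed.

Lemma contract_lB x y : contract_l (x - y) = contract_l x - contract_l y.
Proof. exact: mmapB. Qed.

Lemma skewr_contract a : skewr a f = contract_r (coprod a).
Proof.
rewrite /contract_r mmapE; apply: eq_bigr => p _.
by rewrite -scalerA mulrzl -scaler_int intz.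
Qed.

Lemma skewl_contract a : skewl f a = contract_l (coprod a).
Proof.
rewrite /contract_l mmapE; apply: eq_bigr => p _.
by rewrite -scalerA mulrzl -scaler_int intz.
Qed.

Lemma contract_r_tens a b : contract_r (tensor a b) = f b *: a.
Proof.
move: a; apply: malg_ind.
- by rewrite tens0l scaler0; apply: mmap0.
- move=> x y IHx IHy; rewrite tensBl scalerBr contract_rB.
  by congr (_ - _); [apply: IHx | apply: IHy].
move=> u; move: b; apply: malg_ind.
- by rewrite tens0r raddf0 scale0r; apply: mmap0.
- move=> x y IHx IHy; rewrite tensBr raddfB scalerBl contract_rB.
  by congr (_ - _); [apply: IHx | apply: IHy].
by move=> v; rewrite tensUU [LHS]mmapU mul1r.
Qed.

Lemma contract_l_swap x : contract_l x = contract_r (swap x).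
Proof.
move: x; apply: malg_ind.
- by rewrite swap0 [LHS]mmap0 [RHS]mmap0.
- move=> x y IHx IHy; rewrite swapB contract_lB contract_rB.
  exact: (f_equal2 (fun a b => a - b) IHx IHy).
by move=> [u v]; rewrite swapU [LHS]mmapU [RHS]mmapU.
Qed.

Lemma skewr_skewl a : skewr a f = skewl f a.
Proof. by rewrite skewr_contract skewl_contract contract_l_swap swap_coprod. Qed.

Lemma contract_l_tens a b : contract_l (tensor a b) = f a *: b.
Proof. by rewrite contract_l_swap swap_tens contract_r_tens. Qed.

Lemma skewr_ribbon alpha :
  skewr (sNSym (ribbon alpha)) f
    = \sum_(t | is_decomp alpha t) f (sNSym (dpart alpha t)) *: sNSym (gpart alpha t).
Proof.
rewrite skewr_contract coprod_ribbon [LHS]raddf_sum.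
by apply: eq_bigr => t _; apply: contract_r_tens.
Qed.

Lemma skewl_ribbon alpha :
  skewl f (sNSym (ribbon alpha))
    = \sum_(t | is_decomp alpha t) f (sNSym (gpart alpha t)) *: sNSym (dpart alpha t).
Proof.
rewrite skewl_contract coprod_ribbon [LHS]raddf_sum.
by apply: eq_bigr => t _; apply: contract_l_tens.
Qed.

End Skew.

Lemma Ffun_sNSym b D : sorted ribbon_step D ->
  Ffun b (sNSym D) = (b \in rclass (components D))%:R.
Proof. by move=> sortedD; rewrite sNSym_gschur // Ffun_gschur. Qed.

Theorem proposition5p8 (alpha beta : composition) :
  let s_alpha := sNSym (ribbon alpha) in
  skewr s_alpha (Ffun beta) = skewl (Ffun beta) s_alpha
  /\ (skewr s_alpha (Ffun beta)
        = \sum_(t | is_decomp alpha t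
                    && (beta \in rclass (components (dpart alpha t))))
            sNSym (gpart alpha t)
      /\ skewr s_alpha (Ffun beta)
        = \sum_(t | is_decomp alpha t
                    && (beta \in rclass (components (dpart alpha t))))
            \sum_(gamma' <- rclass (components (gpart alpha t)))
              sNSym (ribbon gamma'))
  /\ (skewl (Ffun beta) s_alpha
        = \sum_(t | is_decomp alpha t
                    && (beta \in rclass (components (gpart alpha t))))
            sNSym (dpart alpha t)
      /\ skewl (Ffun beta) s_alpha
        = \sum_(t | is_decomp alpha t
                    && (beta \in rclass (components (gpart alpha t))))
            \sum_(delta' <- rclass (components (dpart alpha t)))
              sNSym (ribbon delta')).
Proof.
move=> s_alpha.
have skewrE : skewr s_alpha (Ffun beta)
    = \sum_(t | is_decomp alpha t && (beta \in rclass (components (dpart alpha t))))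
        sNSym (gpart alpha t).
  (* The functional takes only the values 0 and 1 on the parts, so its factor becomes a condition on
     the index. *)
  rewrite skewr_ribbon [RHS]big_mkcondr; apply: eq_bigr => t dec_t.
  rewrite Ffun_sNSym; last exact: sorted_dpart.
  by case: (_ \in _); rewrite ?scale1r ?scale0r.
have skewlE : skewl (Ffun beta) s_alpha
    = \sum_(t | is_decomp alpha t && (beta \in rclass (components (gpart alpha t))))
        sNSym (dpart alpha t).
  rewrite skewl_ribbon [RHS]big_mkcondr; apply: eq_bigr => t dec_t.
  rewrite Ffun_sNSym; last exact: sorted_gpart.
  by case: (_ \in _); rewrite ?scale1r ?scale0r.
split; first exact: skewr_skewl.
split; split.
- exact: skewrE.
(* The second form expands each part over its class. *)
- rewrite skewrE; apply: eq_bigr => t /andP[dec_t _].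
  exact/sNSym_rclass/sorted_gpart.
- exact: skewlE.
- rewrite skewlE; apply: eq_bigr => t /andP[dec_t _].
  exact/sNSym_rclass/sorted_dpart.
Qed.
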